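(* For all $\alpha,\beta\in\mathrm{ASP}$, the following minimum in Bruhat order exists: $$\alpha\triangleleft\beta^{-1}=\min\{\gamma\in\mathrm{ASP}:\ \gamma\star\beta\ge\alpha\}.$$ The resulting binary operation $\triangleleft$ on $\mathrm{ASP}$ (the left residual) is characterized by the equation $$s_{\alpha\triangleleft\beta}(a,b)=\max_{\ell\in\mathbb{Z}}\Big[s_\alpha(a,\ell)-s_{\beta^{-1}}(b,\ell)\Big]\qquad\text{for all }\alpha,\beta\in\mathrm{ASP},\ a,b\in\mathbb{Z}.$$ For all $\alpha\in\mathrm{ASP}$ and $n\in\mathbb{Z}$, $$\alpha\triangleleft\sigma_n=\begin{cases}\alpha\sigma_n&\text{if }\alpha(n)>\alpha(n+1),\\ \alpha&\text{otherwise.}\end{cases}$$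
   Context: A permutation means a bijection $\mathbb{Z}\to\mathbb{Z}$; products of permutations are compositions. $\mathrm{ASP}$ is the group of permutations $\alpha$ for which only finitely many $n\in\mathbb{Z}$ have exactly one of $n,\alpha(n)$ negative. For $\alpha\in\mathrm{ASP}$, $s_\alpha(a,b)=\#\{n\ge b:\ \alpha(n)<a\}$ for $a,b\in\mathbb{Z}$ (always finite; $s_\alpha$ determines $\alpha$). Bruhat order on $\mathrm{ASP}$: $\alpha\le\beta$ means $s_\alpha(a,b)\le s_\beta(a,b)$ for all $a,b\in\mathbb{Z}$. The Demazure product $\alpha\star\beta$ is the unique element of $\mathrm{ASP}$ such that $s_{\alpha\star\beta}(a,b)=\min_{\ell\in\mathbb{Z}}[s_\alpha(a,\ell)+s_\beta(\ell,b)]$ for all $a,b\in\mathbb{Z}$ (such an element always exists). $\sigma_n$ is the transposition exchanging $n$ and $n+1$ and fixing all other integers. *)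

(* Defs.v *)
From HB Require Import structures.
From mathcomp Require Import all_boot all_order all_algebra finmap.
From mathcomp Require Import boolp classical_sets functions cardinality.

Set Implicit Arguments.
Unset Strict Implicit.
Unset Printing Implicit Defensive.

Import Order.TTheory GRing.Theory Num.Theory.

Local Open Scope classical_set_scope.
Local Open Scope ring_scope.

Definition sign_changes (f : int -> int) : set int :=
  [set n | (n < 0) != (f n < 0)].

Record asp := Asp {
  asp_fun :> int -> int;
  asp_bij : bijective asp_fun;
  asp_fin : finite_set (sign_changes asp_fun)
}.

Lemma asp_eqP (f g : asp) : f =1 g -> f = g.
Proof.
case: f g => [f fb ff] [g gb gf] /= /funext efg.
by subst g; congr Asp; exact: Prop_irrelevance.
Qed.

HB.instance Definition _ := gen_eqMixin asp.
HB.instance Definition _ := gen_choiceMixin asp.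

Lemma asp_one_fin : finite_set (sign_changes id).
Proof.
rewrite (_ : sign_changes id = set0) //.
by apply/seteqP; split => n //=; rewrite /sign_changes /= eqxx.
Qed.

Definition asp_one : asp := Asp (Bijective (frefl _) (frefl _)) asp_one_fin.

Lemma asp_mul_fin (f g : asp) : finite_set (sign_changes (f \o g)).
Proof.
apply: (@sub_finite_set _ _ (sign_changes g `|` g @^-1` sign_changes f)).
  move=> n; rewrite /sign_changes /=.
  by case: (n < 0); case: (g n < 0); case: (f (g n) < 0); auto.
rewrite finite_setU; split; first exact: asp_fin.
apply: finite_preimage (asp_fin f) => x y _ _.
exact: bij_inj (asp_bij g) _ _.
Qed.

Definition asp_mul (f g : asp) : asp :=
  Asp (bij_comp (asp_bij f) (asp_bij g)) (asp_mul_fin f g).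

Definition asp_invf (f : asp) (y : int) : int := xget 0 [set x | f x = y].

Lemma asp_invfK (f : asp) : cancel (asp_invf f) f.
Proof.
move=> y; have [g fK gK] := asp_bij f.
exact: (@xgetI _ 0 [set x | f x = y] (g y) (gK y)).
Qed.

Lemma asp_funK (f : asp) : cancel f (asp_invf f).
Proof. by move=> x; apply: (bij_inj (asp_bij f)); rewrite asp_invfK. Qed.

Lemma asp_inv_fin (f : asp) : finite_set (sign_changes (asp_invf f)).
Proof.
apply: (@sub_finite_set _ _ (f @` sign_changes f)).
  move=> y; rewrite /sign_changes /= => H; exists (asp_invf f y).
    by rewrite asp_invfK eq_sym.
  exact: asp_invfK.
exact: finite_image (asp_fin f).
Qed.

Definition asp_inv (f : asp) : asp :=
  Asp (Bijective (asp_invfK f) (asp_funK f)) (asp_inv_fin f).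

Lemma asp_mulA : associative asp_mul.
Proof. by move=> f g h; apply: asp_eqP. Qed.

Lemma asp_mul1 : left_id asp_one asp_mul.
Proof. by move=> f; apply: asp_eqP. Qed.

Lemma asp_mulr1 : right_id asp_one asp_mul.
Proof. by move=> f; apply: asp_eqP. Qed.

Lemma asp_mulV : left_inverse asp_one asp_inv asp_mul.
Proof. by move=> f; apply: asp_eqP => x; apply: asp_funK. Qed.

Lemma asp_mulrV : right_inverse asp_one asp_inv asp_mul.
Proof. by move=> f; apply: asp_eqP => x; apply: asp_invfK. Qed.

(* Unlike for {perm T}, the product is (f * g) x = f (g x). *)
HB.instance Definition _ :=
  isGroup.Build asp asp_mulA asp_mul1 asp_mulr1 asp_mulV asp_mulrV.

Definition transp (n x : int) : int :=
  if x == n then n + 1 else if x == n + 1 then n else x.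

Lemma transpK n : involutive (transp n).
Proof.
have nn : (n + 1 == n) = false by rewrite -subr_eq0 addrAC subrr add0r.
move=> x; rewrite /transp.
case: (eqVneq x n) => [->|xn]; first by rewrite nn eqxx.
case: (eqVneq x (n + 1)) => [->|xn1]; first by rewrite eqxx.
by rewrite (negbTE xn) (negbTE xn1).
Qed.

Lemma transp_fin n : finite_set (sign_changes (transp n)).
Proof.
apply: (@sub_finite_set _ _ ([set n] `|` [set n + 1])).
  move=> x; rewrite /sign_changes /transp /=.
  by case: (eqVneq x n); [left | case: (eqVneq x (n + 1)); [right | rewrite eqxx]].
by rewrite finite_setU; split; exact: finite_set1.
Qed.

Definition sigma (n : int) : asp := Asp (inv_bij (transpK n)) (transp_fin n).

Definition sset (f : int -> int) (a b : int) : set int :=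
  [set n | b <= n /\ f n < a].

Lemma finite_int_itv (a b : int) : finite_set [set n : int | a <= n /\ n < b].
Proof.
apply: (@sub_finite_set _ _ ((fun k : nat => a + k%:Z) @` `I_(`|b - a|%N))).
  move=> n /= [an nb]; exists `|n - a|%N; last first.
    by rewrite gez0_abs ?subr_ge0 // subrKC.
  rewrite -ltz_nat !gez0_abs ?subr_ge0 // ?ltrD2r //.
  exact: le_trans an (ltW nb).
exact: finite_image (finite_II _).
Qed.

Lemma sset_finite (f : asp) a b : finite_set (sset f a b).
Proof.
apply: (@sub_finite_set _ _ (sign_changes f `|`
  (f @^-1` [set n | 0 <= n /\ n < a] `|` [set n | b <= n /\ n < 0]))).
  move=> n; rewrite /sset /sign_changes /= => -[bn na].
  case: (ltP n 0) => n0; first by right; right.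
  by case: (ltP (f n) 0) => fn0; [left | right; left].
rewrite !finite_setU; split; first exact: asp_fin.
split; last exact: finite_int_itv.
apply: finite_preimage (finite_int_itv _ _) => x y _ _.
exact: bij_inj (asp_bij f) _ _.
Qed.

(* fset_set sends infinite sets to fset0; by sset_finite this never occurs. *)
Definition s (f : asp) (a b : int) : nat := #|` fset_set (sset f a b)|.

Definition bruhat (f g : asp) : Prop := forall a b, (s f a b <= s g a b)%N.

Lemma s_step (f : asp) a b : s f a b = ((f b < a)%R + s f a (b + 1)%R)%N.
Proof.
case fba: (f b < a); rewrite /s; last first.
  congr (#|` fset_set _|); apply/seteqP; split=> n [bn na]; split=> //.
    rewrite lezD1 lt_neqAle bn andbT.
    by apply: contraFN fba => /eqP ->.
  by apply: le_trans bn; rewrite lerDl.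
rewrite (_ : sset f a b = b |` sset f a (b + 1)).
  rewrite fset_setU1; last exact: sset_finite.
  rewrite cardfsU1 in_fset_set; last exact: sset_finite.
  rewrite (_ : (b \in _) = false) //.
  by apply: memNset => -[]; rewrite lezD1 ltxx.
apply/seteqP; split=> n.
  move=> [bn na]; have [->|nb] := eqVneq n b; [by left | right; split=> //].
  by rewrite lezD1 lt_neqAle bn andbT eq_sym.
move=> [-> | [bn na]]; first by split.
by split=> //; apply: le_trans bn; rewrite lerDl.
Qed.

Lemma s_inj (f g : asp) : (forall a b, s f a b = s g a b) -> f = g.
Proof.
move=> sE; apply: asp_eqP => b.
have lt_fg a : (f b < a) = (g b < a).
  apply/eqP; move: (sE a b); rewrite (s_step f) (s_step g) sE => /addIn.
  by case: (f b < a); case: (g b < a).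
apply/eqP; rewrite eq_le -ltzD1 lt_fg ltzD1 lexx /=.
by rewrite -ltzD1 -lt_fg ltzD1.
Qed.

Definition bruhat_min (A : set asp) (m : asp) : Prop :=
  A m /\ forall g, A g -> bruhat m g.

Definition is_min (u : int -> int) (m : int) : Prop :=
  range u m /\ lbound (range u) m.

Definition is_max (u : int -> int) (m : int) : Prop :=
  range u m /\ ubound (range u) m.

Definition is_demazure (f g h : asp) : Prop :=
  forall a b, is_min (fun l => (s f a l)%:Z + (s g l b)%:Z) (s h a b)%:Z.

Lemma is_demazure_inj (f g h k : asp) :
  is_demazure f g h -> is_demazure f g k -> h = k.
Proof.
move=> H K; apply: s_inj => a b; apply/eqP; rewrite -eqz_nat eq_le.
have [rH lH] := H a b; have [rK lK] := K a b.
by apply/andP; split; [exact: lH | exact: lK].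
Qed.

Lemma bruhat_min_inj (A : set asp) (m k : asp) :
  bruhat_min A m -> bruhat_min A k -> m = k.
Proof.
move=> [Am lm] [Ak lk]; apply: s_inj => a b; apply/eqP.
by rewrite eqn_leq lm // lk.
Qed.

(* Definite description; the default 1 is irrelevant since the Demazure
   product always exists. *)
Definition demazure (f g : asp) : asp := xget 1%g [set h | is_demazure f g h].

(* Definite description of a Bruhat minimum, with default 1 if there is none. *)
Definition lresidual (f g : asp) : asp :=
  xget 1%g [set m | bruhat_min [set h | bruhat f (demazure h g^-1%g)] m].

(* Main.v *)
Require Import Defs.
From HB Require Import structures.
From mathcomp Require Import all_boot all_order all_algebra finmap.
From mathcomp Require Import boolp classical_sets functions cardinality.
From mathcomp Require Import zify.

(** A permutation is encoded by its rank function [s f], whose second difference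
is the permutation matrix of [f].  Hence the functions of two integer variables
that are rank functions can be recognised ([s_realize]): they are submodular,
and towards the four ends of the plane they agree with [0] or with [a - b + c]
for one constant [c], the shift of [f].  Conversely a rank function satisfies
all this; the identity [s_shift] exchanges [f] with its inverse and thereby
reduces the two [a - b + c] ends to the two ends where rank functions vanish.

The min-plus product [min_l (s f a l + s g l b)] and the residual
[max_l (s f a l - s g b l)] both inherit these properties.  Submodularity is
an exchange argument: take optimal [l] and [l'] at two opposite corners of a unit
square, and use the same two indices, swapped or not according to their order, as
candidates at the other two corners.  So the Demazure product exists
([demazure_exists]), and so does a permutation [h] with rank function the
residual ([residual_exists]).

By the formula for the Demazure product, [bruhat f (demazure h g)] says that
[s f a b - s g l b <= s h a l] for all [a], [b], [l] ([bruhat_demazure]).  The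
residual rank function is the least function [s h] satisfying this, so its
permutation is the Bruhat minimum ([residual_min]).  Bruhat minima are unique, so
the max formula characterises the residual, and the case of [sigma n] becomes the
evaluation of one maximum ([lresidual_sigma]). *)

Set Implicit Arguments.
Unset Strict Implicit.
Unset Printing Implicit Defensive.

Import Order.TTheory GRing.Theory Num.Theory.

Local Open Scope classical_set_scope.
Local Open Scope ring_scope.

(** * Integer functions, minima and maxima *)

Lemma int_const (d : int -> int) :
  (forall x : int, d (x + 1) = d x) -> forall x y : int, d x = d y.
Proof.
move=> dS; suff d0 x : d x = d 0 by move=> x y; rewrite d0 (d0 y).
elim: x => [//|n IHn|n IHn].
  by rewrite -IHn -(dS n); congr d; lia.
by rewrite -IHn -(dS (- n.+1%:Z)); congr d; lia.
Qed.

Lemma finite_int_bounded (A : set int) :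
  finite_set A -> exists N : int, forall x : int, A x -> - N < x < N.
Proof.
move=> /finite_seqP [r ->]; elim: r => [|y r [N IH]]; first by exists 0.
exists (Num.max N (`|y| + 1)) => x /=; rewrite inE => /orP [/eqP ->|/IH]; lia.
Qed.

Lemma is_maxP (u : int -> int) (m : int) :
  is_max u m <-> (exists l : int, u l = m) /\ forall l : int, u l <= m.
Proof.
split=> [[[l _ ul] um]|[[l ul] um]]; split.
- by exists l.
- by move=> k; apply: um; exists k.
- by exists l.
- by move=> _ [k _ <-].
Qed.

Lemma is_minP (u : int -> int) (m : int) :
  is_min u m <-> (exists l : int, u l = m) /\ forall l : int, m <= u l.
Proof.
split=> [[[l _ ul] um]|[[l ul] um]]; split.
- by exists l.
- by move=> k; apply: um; exists k.
- by exists l.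
- by move=> _ [k _ <-].
Qed.

Lemma bounded_is_min (u : int -> int) (K : int) :
  (forall l : int, K <= u l) -> exists m : int, is_min u m.
Proof.
move=> Ku; pose P k := `[< exists l : int, u l = K + k%:Z >].
have exP : exists k, P k.
  by exists `|(u 0 - K)%R|%N; apply/asboolP; exists 0; have := Ku 0; lia.
have [k /asboolP [l ul] kmin] := ex_minnP exP.
exists (u l); apply/is_minP; split=> [|l']; first by exists l.
have -> : u l' = K + `|u l' - K|%N%:Z by have := Ku l'; lia.
rewrite ul lerD2l lez_nat; apply: kmin; apply/asboolP; exists l'.
by have := Ku l'; lia.
Qed.

Lemma bounded_is_max (u : int -> int) (K : int) :
  (forall l : int, u l <= K) -> exists m : int, is_max u m.
Proof.
move=> uK; have [|m /is_minP [[l ul] um]] := @bounded_is_min (fun l => - u l) (- K).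
  by move=> l; rewrite lerN2.
exists (- m); apply/is_maxP; split; first by exists l; lia.
by move=> k; have := um k; lia.
Qed.

(** * Variation and vanishing of rank functions *)

Lemma asp_invK : involutive asp_inv.
Proof. by move=> f; exact: (invgK f). Qed.

(** The element that enters when the bound on values rises from [a] to [a + 1]
is the preimage of [a]. *)
Lemma s_stepl (f : asp) a b :
  s f (a + 1) b = (s f a b + (b <= asp_inv f a)%R)%N.
Proof.
pose m := asp_inv f a; rewrite -/m.
have fm : f m = a by apply: asp_invfK.
have f_a n : f n = a -> n = m by rewrite /m => <- /=; rewrite asp_funK.
case bm: (b <= m); rewrite /s; last first.
  rewrite addn0; congr (#|` fset_set _|); apply/seteqP.
  split=> n [bn na]; split=> //; last by lia.
  have /eqP : f n != a by apply/eqP => /f_a nm; rewrite -nm bn in bm.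
  lia.
rewrite (_ : sset f (a + 1) b = m |` sset f a b).
  rewrite fset_setU1; last exact: sset_finite.
  rewrite cardfsU1 in_fset_set; last exact: sset_finite.
  rewrite (_ : (m \in _) = false) 1?addnC //.
  by apply: memNset => -[]; rewrite fm ltxx.
apply/seteqP; split=> n.
  move=> [bn na]; have [/f_a|fa] := eqVneq (f n) a; first by left.
  by right; split=> //; lia.
move=> [-> | [bn na]]; split=> //; last by lia.
by rewrite fm; lia.
Qed.

(** The difference [s f a b - s (asp_inv f) b a] counts the [n >= b] sent below
[a] minus the [n < b] sent to [a] or above.  Moving [a] or [b] by one changes it
by exactly one, in the direction of [a - b]. *)
Lemma s_shift (f : asp) : exists c : int, forall a b : int,
  (s f a b)%:Z = a - b + c + (s (asp_inv f) b a)%:Z.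
Proof.
pose d a b : int := (s f a b)%:Z - (s (asp_inv f) b a)%:Z + b - a.
have dl a b b' : d a b = d a b'.
  apply: int_const (d a) _ _ _ => x; rewrite /d s_stepl asp_invK (s_step f a x).
  by lia.
have dr b a a' : d a b = d a' b.
  apply: int_const (d^~ b) _ _ _ => x; rewrite /d s_stepl (s_step _ b x).
  by lia.
exists (d 0 0) => a b; rewrite (dl 0 0 b) (dr b 0 a) /d; lia.
Qed.

(** Rank functions are nonincreasing and 1-Lipschitz in the second variable;
together with [s_shift] this also controls the first variable. *)
Lemma s_le (f : asp) a b b' : b <= b' ->
  (s f a b' <= s f a b)%N /\ (s f a b)%:Z <= (s f a b')%:Z + (b' - b).
Proof.
move=> bb'; have -> : b' = b + `|b' - b|%N%:Z by lia.
elim: (`|b' - b|%N) => [|k IHk]; first by rewrite addr0; lia.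
have -> : b + k.+1%:Z = b + k%:Z + 1 by lia.
by move: IHk; rewrite (s_step f a (b + k%:Z)); lia.
Qed.

Lemma s_eq0 (f : asp) a b : (forall n, b <= n -> a <= f n) -> s f a b = 0%N.
Proof.
move=> H; rewrite /s (_ : sset f a b = set0) ?fset_set0 ?cardfs0 //.
by apply/seteqP; split=> n // -[/H fn]; rewrite ltNge fn.
Qed.

(** The two lemmas below describe the ends where a rank function is [0].  Applied
to [asp_inv f], they give through [s_shift] the ends where [s f a b] equals
[a - b + c]. *)
Lemma s_vanish_right (f : asp) a :
  exists B : int, forall b : int, B <= b -> s f a b = 0%N.
Proof.
have [N HN] := finite_int_bounded (sset_finite f a 0).
exists (Num.max 0 N) => b Bb; apply: s_eq0 => n bn.
rewrite leNgt; apply/negP => fn.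
have : - N < n < N by apply: HN; split=> //; lia.
lia.
Qed.

Lemma s_vanish_left (f : asp) b :
  exists A : int, forall a : int, a <= A -> s f a b = 0%N.
Proof.
have [N HN] := finite_int_bounded (finite_image f (sset_finite f 0 b)).
exists (Num.min 0 (- N)) => a Aa; apply: s_eq0 => n bn.
rewrite leNgt; apply/negP => fn.
have : - N < f n < N by apply: HN; exists n => //; split=> //; lia.
lia.
Qed.

(** The step relation in [b] and vanishing for large [b] determine a rank
function, so a closed formula for [s f a] is verified by these two checks. *)
Lemma s_unique (f : asp) (a : int) (t : int -> int) :
  (forall b : int, t b = (f b < a)%R%:Z + t (b + 1)) ->
  (exists B : int, forall b : int, B <= b -> t b = 0) ->
  forall b : int, (s f a b)%:Z = t b.
Proof.
move=> tS [B tB] b; have [B' sB] := s_vanish_right f a.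
pose d x := (s f a x)%:Z - t x.
have /(_ b (Num.max B B')) : forall x y : int, d x = d y.
  apply: int_const => x; rewrite /d (s_step f a x) (tS x); lia.
rewrite /d (tB (Num.max B B')) ?(sB (Num.max B B')); lia.
Qed.

(** * Recognising rank functions *)

Lemma nondecr_int (D : int -> int) :
  (forall a : int, D a <= D (a + 1)) -> {homo D : x y / x <= y}.
Proof.
move=> DS x y xy; have -> : y = x + `|y - x|%N%:Z by lia.
elim: (`|y - x|%N) => [|k /le_trans -> //]; first by rewrite addr0.
by rewrite (_ : x + k.+1%:Z = x + k%:Z + 1) //; lia.
Qed.

(** The limits [0] and [1] force a nondecreasing integer function to be the
indicator of a half-line; this turns differences of a rank function back into
values of a permutation. *)
Lemma threshold (D : int -> int) (A A' : int) :
  (forall a : int, D a <= D (a + 1)) ->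
  (forall a : int, a <= A -> D a = 0) -> (forall a : int, A' <= a -> D a = 1) ->
  exists v : int, forall a : int, D a = (v < a)%R%:Z.
Proof.
move=> /nondecr_int D_le D0 D1.
have exP : exists k : nat, 0 < D (A + k%:Z).
  by exists (`|A' - A|%N); rewrite D1; lia.
have [k Dk kmin] := ex_minnP exP.
exists (A + k%:Z - 1) => a.
case: (ltP (A + k%:Z - 1) a) => aA.
  have ak : A + k%:Z <= a by lia.
  have := D_le _ _ ak; have am : a <= Num.max a A' by lia.
  by have := D_le _ _ am; rewrite (D1 (Num.max a A')); lia.
have [aA'|Aa] := leP a A; first exact: D0.
have : 0 <= D a by rewrite -(D0 A) ?D_le //; lia.
have : ~~ (0 < D a).
  apply/negP => Da; have := kmin `|a - A|%N.
  by rewrite (_ : A + _ = a); [move=> /(_ Da); lia | lia].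
lia.
Qed.

(** The difference of [t] in [b] is nondecreasing in [a] and goes from [0] to [1],
so it is the indicator of [f b < a] for some [f]; the difference in [a] likewise
defines a function [w].  The second difference of [t] at [(a, b)] is [1] exactly
when [f b = a], and also exactly when [w a = b], so [f] and [w] are inverse to
each other.  The behaviour of [t 0 b] at both ends bounds the sign changes. *)
Lemma s_realize (t : int -> int -> int) (c : int) :
  (forall a b : int, t a b + t (a + 1) (b + 1) <= t (a + 1) b + t a (b + 1)) ->
  (forall a : int, exists B : int, forall b : int, B <= b -> t a b = 0) ->
  (forall a : int, exists B : int, forall b : int, b <= B -> t a b = a - b + c) ->
  (forall b : int, exists A : int, forall a : int, a <= A -> t a b = 0) ->
  (forall b : int, exists A : int, forall a : int, A <= a -> t a b = a - b + c) ->
  exists f : asp, forall a b : int, (s f a b)%:Z = t a b.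
Proof.
move=> monge tR tL tD tU.
have /choice [f fP] : forall b : int, exists v : int, forall a : int,
    t a b - t a (b + 1) = (v < a)%R%:Z.
  move=> b.
  have [A0 t0] := tD b; have [A1 t1] := tD (b + 1).
  have [A2 t2] := tU b; have [A3 t3] := tU (b + 1).
  apply: (@threshold _ (Num.min A0 A1) (Num.max A2 A3)) => a.
  - by have := monge a b; lia.
  - by move=> aA; rewrite t0 ?t1; lia.
  - by move=> aA; rewrite t2 ?t3; lia.
have /choice [w wP] : forall a : int, exists v : int, forall b : int,
    1 - (t (a + 1) b - t a b) = (v < b)%R%:Z.
  move=> a.
  have [A0 t0] := tL a; have [A1 t1] := tL (a + 1).
  have [A2 t2] := tR a; have [A3 t3] := tR (a + 1).
  apply: (@threshold _ (Num.min A0 A1) (Num.max A2 A3)) => b.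
  - by have := monge a b; lia.
  - by move=> aA; rewrite t0 ?t1; lia.
  - by move=> aA; rewrite t2 ?t3; lia.
have fw a b : (f b == a) = (w a == b).
  have := fP b a; have := fP b (a + 1); have := wP a b; have := wP a (b + 1).
  lia.
have fbij : bijective f.
  exists w => x; first by apply/eqP; rewrite -fw.
  by apply/eqP; rewrite fw.
(* Where t 0 vanishes near n, f n is nonnegative; where t 0 has slope -1, f n is
   negative. *)
have ffin : finite_set (sign_changes f).
  have [B tB] := tR 0; have [B' tB'] := tL 0.
  apply: sub_finite_set (finite_int_itv (Num.min 0 (B' - 1)) (Num.max 0 B)).
  move=> n; rewrite /sign_changes /=; have := fP n 0.
  have := tB n; have := tB (n + 1); have := tB' n; have := tB' (n + 1).
  by lia.
exists (Asp fbij ffin) => a; apply: s_unique => [b|]; last exact: tR.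
by have := fP b a => /=; lia.
Qed.

(** * The Demazure product and the residual *)

(** The minimum is at most the value at any [l].  At each end it is enough to
choose [l] so that one term already has its extreme form, either [0] or the
difference plus shift, and then to move the outer variable until the other term
does too; the extreme forms are also lower bounds for every [l]. *)
Lemma demazure_exists (f g : asp) : exists h, is_demazure f g h.
Proof.
pose u a b l := (s f a l)%:Z + (s g l b)%:Z.
have /choice [t tP] : forall a : int, exists ta : int -> int,
    forall b : int, is_min (u a b) (ta b).
  move=> a; suff /choice [ta taP] : forall b, exists m, is_min (u a b) m.
    by exists ta.
  move=> b.
  by apply: (@bounded_is_min _ 0) => l; rewrite /u; lia.
have t_le a b l : t a b <= u a b l by have /is_minP [_] := tP a b.
have [cf fS] := s_shift f; have [cg gS] := s_shift g.
suff [h hE] : exists h : asp, forall a b : int, (s h a b)%:Z = t a b.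
  by exists h => a b; rewrite hE; exact: tP.
apply: (@s_realize t (cf + cg)).
- move=> a b.
  (* Optimal l at (a + 1, b) and l' at (a, b + 1): if l' <= l the step of s g
     lets them serve at (a + 1, b + 1) and (a, b); otherwise the step of s f
     lets them serve at (a, b) and (a + 1, b + 1). *)
  have /is_minP [[l <-] _] := tP (a + 1) b.
  have /is_minP [[l' <-] _] := tP a (b + 1).
  have [ll|ll] := leP l' l.
    have := t_le a b l'; have := t_le (a + 1) (b + 1) l; rewrite /u.
    by rewrite (s_step g l b) (s_step g l' b); lia.
  have := t_le a b l; have := t_le (a + 1) (b + 1) l'; rewrite /u.
  by rewrite !(s_stepl f); lia.
- move=> a; have [l fl] := s_vanish_right f a.
  have [B gB] := s_vanish_right g l; exists B => b Bb.
  have := t_le a b l; rewrite /u fl // gB //.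
  by have /is_minP [[k <-] _] := tP a b; rewrite /u; lia.
- move=> a; have [l fl] := s_vanish_left (asp_inv f) a.
  have [B gB] := s_vanish_left (asp_inv g) l; exists B => b Bb.
  have := t_le a b l; rewrite /u fS fl // gS gB //.
  by have /is_minP [[k <-] _] := tP a b; rewrite /u fS gS; lia.
- move=> b; have [l gl] := s_vanish_left g b.
  have [A fA] := s_vanish_left f l; exists A => a Aa.
  have := t_le a b l; rewrite /u gl // fA //.
  by have /is_minP [[k <-] _] := tP a b; rewrite /u; lia.
- move=> b; have [l gl] := s_vanish_right (asp_inv g) b.
  have [A fA] := s_vanish_right (asp_inv f) l; exists A => a Aa.
  have := t_le a b l; rewrite /u gS gl // fS fA //.
  by have /is_minP [[k <-] _] := tP a b; rewrite /u fS gS; lia.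
Qed.

Lemma demazureP (f g : asp) : is_demazure f g (demazure f g).
Proof. by have [h hP] := demazure_exists f g; exact: xgetI hP. Qed.

(** The maximum is at least [0] and at least [a - b + (cf - cg)], from the values
at large and at very negative [l].  What has to be shown at each end is that one
of these bounds is an upper bound for all [l] at once.  For this, pick a point
[N] or [M] beyond which one of the two rank functions has its extreme form; on
the other side of that point the 1-Lipschitz property of one rank function is
played against the linear lower bound of the other. *)
Lemma residual_exists (f g : asp) : exists h : asp, forall a b : int,
  is_max (fun l => (s f a l)%:Z - (s g b l)%:Z) (s h a b)%:Z.
Proof.
pose u a b l := (s f a l)%:Z - (s g b l)%:Z.
have [cf fS] := s_shift f; have [cg gS] := s_shift g.
have /choice [t tP] : forall a : int, exists ta : int -> int,
    forall b : int, is_max (u a b) (ta b).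
  move=> a; suff /choice [ta taP] : forall b, exists m, is_max (u a b) m.
    by exists ta.
  move=> b.
  have [N fN] := s_vanish_right f a.
  apply: (@bounded_is_max _ (Num.max 0 (N - b - cg))) => l; rewrite /u.
  have [Nl|lN] := leP N l; first by rewrite fN //; lia.
  by have [_] := s_le f a (ltW lN); rewrite (fN N) // gS; lia.
have t_ge a b l : u a b l <= t a b by have /is_maxP [_] := tP a b.
have t_le a b K : (forall l : int, u a b l <= K) -> t a b <= K.
  by move=> uK; have /is_maxP [[l <-] _] := tP a b.
have t_ge0 a b : 0 <= t a b.
  have [l gl] := s_vanish_right g b; have := t_ge a b l.
  by rewrite /u gl //; lia.
have t_gec a b : a - b + (cf - cg) <= t a b.
  have [l gl] := s_vanish_left (asp_inv g) b; have := t_ge a b l.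
  by rewrite /u gS gl // fS; lia.
suff [h hE] : exists h : asp, forall a b : int, (s h a b)%:Z = t a b.
  by exists h => a b; rewrite hE; exact: tP.
apply: (@s_realize t (cf - cg)).
- move=> a b.
  (* Optimal l at (a, b) and l' at (a + 1, b + 1): if l <= l' the step of s f
     moves them to (a + 1, b) and (a, b + 1); otherwise the step of s g moves
     them the other way round. *)
  have /is_maxP [[l <-] _] := tP a b.
  have /is_maxP [[l' <-] _] := tP (a + 1) (b + 1).
  have [ll|ll] := leP l l'.
    have := t_ge (a + 1) b l; have := t_ge a (b + 1) l'; rewrite /u.
    by rewrite !(s_stepl f); lia.
  have := t_ge (a + 1) b l'; have := t_ge a (b + 1) l; rewrite /u.
  by rewrite !(s_stepl g); lia.
- move=> a; have [N fN] := s_vanish_right f a.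
  exists (N - cg) => b Nb; apply/le_anti; rewrite t_ge0 andbT.
  apply: t_le => l; rewrite /u.
  have [Nl|lN] := leP N l; first by rewrite fN //; lia.
  by have [_] := s_le f a (ltW lN); rewrite (fN N) // gS; lia.
- move=> a; have [M fM] := s_vanish_left (asp_inv f) a.
  exists (M - cg) => b bM; apply/le_anti; rewrite t_gec andbT.
  apply: t_le => l; rewrite /u.
  have [lM|Ml] := leP l M; first by rewrite fS fM // gS; lia.
  have fMM := fS a M; rewrite fM // in fMM.
  by have [+ _] := s_le f a (ltW Ml); lia.
- move=> b; have [M gM] := s_vanish_left (asp_inv g) b.
  have [A fA] := s_vanish_left f M; exists A => a aA.
  apply/le_anti; rewrite t_ge0 andbT; apply: t_le => l; rewrite /u.
  have gMM := gS b M; rewrite gM // in gMM.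
  have [Ml|lM] := leP M l; first by have [+ _] := s_le f a Ml; rewrite fA //; lia.
  by have [_ +] := s_le f a (ltW lM); rewrite fA // gS gM; lia.
- move=> b; have [N gN] := s_vanish_right g b.
  have [A fA] := s_vanish_right (asp_inv f) N; exists A => a Aa.
  apply/le_anti; rewrite t_gec andbT; apply: t_le => l; rewrite /u.
  have gNN := gS b N; rewrite gN // in gNN.
  have fNN := fS a N; rewrite fA // in fNN.
  have [Nl|lN] := leP N l; first by have [+ _] := s_le f a Nl; rewrite gN //; lia.
  by have [_ +] := s_le f a (ltW lN); rewrite gS; lia.
Qed.

(** The adjunction behind the residual: a lower bound for a minimum over [l] is a
lower bound for each term, and [s g l b] can then be moved across. *)
Lemma bruhat_demazure (f g h : asp) :
  bruhat f (demazure h g) <->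
  forall a b l : int, (s f a b)%:Z - (s g l b)%:Z <= (s h a l)%:Z.
Proof.
split=> [fhg a b l|H a b].
  have /is_minP [_ /(_ l)] := @demazureP h g a b.
  by have := fhg a b; lia.
have /is_minP [[l hl] _] := @demazureP h g a b.
by have := H a b l; lia.
Qed.

Lemma residual_min (f g h : asp) :
  (forall a b : int, is_max (fun l => (s f a l)%:Z - (s g b l)%:Z) (s h a b)%:Z) ->
  bruhat_min [set k | bruhat f (demazure k g)] h.
Proof.
move=> hP; split=> /= [|k /bruhat_demazure fk a b].
  by apply/bruhat_demazure => a b l; have /is_maxP [_ /(_ b)] := hP a l.
by have /is_maxP [[l ul] _] := hP a b; have := fk a l b; lia.
Qed.

Lemma lresidual_eq (f g h : asp) :
  (forall a b : int, is_max (fun l => (s f a l)%:Z - (s g^-1%g b l)%:Z) (s h a b)%:Z) ->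
  lresidual f g = h.
Proof.
move=> /residual_min hP; apply: (bruhat_min_inj _ hP).
exact: (@xgetI _ 1%g [set m | bruhat_min _ m] h hP).
Qed.

Lemma lresidualP (f g : asp) a b :
  is_max (fun l => (s f a l)%:Z - (s g^-1%g b l)%:Z) (s (lresidual f g) a b)%:Z.
Proof.
by have [h hP] := residual_exists f g^-1%g; rewrite (lresidual_eq hP).
Qed.

(** * Residual by a simple transposition *)

(** For [b] other than [n + 1], the half-line starting at [b] is stable under the
swap, so that only [b = n + 1] sees it. *)
Lemma s_mul_sigma (f : asp) (n a b : int) :
  (s (f * sigma n)%g a b)%:Z =
  (s f a b)%:Z +
    (if b == n + 1 then (f n < a)%R%:Z - (f (n + 1) < a)%R%:Z else 0).
Proof.
move: b; apply: s_unique => [b|].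
  rewrite (s_step f a b) /= /transp.
  case: (eqVneq b n) => [->|bn]; first by rewrite eqxx; case: eqP; lia.
  case: (eqVneq b (n + 1)) => [->|bn1]; first by case: eqP; lia.
  by case: eqP; lia.
have [B fB] := s_vanish_right f a; exists (Num.max B (n + 2)) => b Bb.
have -> : (b == n + 1) = false by lia.
by rewrite (fB b); lia.
Qed.

Lemma s_one (a b : int) : (s 1%g a b)%:Z = Num.max 0 (a - b).
Proof.
move: b; apply: s_unique => [b /=|]; first by lia.
by exists a => b; lia.
Qed.

Lemma s_sigma (n a b : int) :
  (s (sigma n) a b)%:Z =
  Num.max 0 (a - b) + ((a == n + 1) && (b == n + 1))%:Z.
Proof. rewrite -[sigma n]mul1g s_mul_sigma s_one /=; case: eqP => /=; lia. Qed.

Lemma sigmaV n : (sigma n)^-1%g = sigma n.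
Proof.
apply/eqP; rewrite eq_sym -mulg_eq1; apply/eqP.
by apply: asp_eqP => x /=; rewrite transpK.
Qed.

(** For [b] other than [n + 1], the max formula subtracts only [max 0 (b - l)],
and the 1-Lipschitz property puts the maximum at [l = b].  For [b = n + 1] one
more is subtracted at [l = n + 1], and the maximum is reached at [n] or [n + 2]:
it exceeds [s f a (n + 2)] by one exactly when both [f n] and [f (n + 1)] lie
below [a], that is, when the larger of them does.  The permutation with this
rank function is the one of [f] and [f * sigma n] that has its larger value of
the two at [n + 1]. *)
Lemma lresidual_sigma (f : asp) (n : int) :
  lresidual f (sigma n) = if f (n + 1) < f n then (f * sigma n)%g else f.
Proof.
apply: lresidual_eq => a b; rewrite sigmaV.
have sE : (s (if f (n + 1) < f n then (f * sigma n)%g else f) a b)%:Z =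
    if b == n + 1 then
      (s f a (n + 2))%:Z + ((f n < a) && (f (n + 1) < a))%:Z
    else (s f a b)%:Z.
  have fS := s_step f a (n + 1); rewrite (_ : n + 1 + 1 = n + 2) in fS; last by lia.
  case: ifP => ff; rewrite ?s_mul_sigma; case: (eqVneq b (n + 1)) => [->|_]; lia.
rewrite {}sE.
have Slip l l' : (s f a l)%:Z <= (s f a l')%:Z + Num.max 0 (l' - l).
  have [ll|ll] := leP l l'; first by have [_] := s_le f a ll; lia.
  by have [+ _] := s_le f a (ltW ll); lia.
apply/is_maxP; split=> [|l]; last first.
  rewrite s_sigma; case: (eqVneq b (n + 1)) => [->|bn] /=; last by have := Slip l b; lia.
  have := Slip l n; have := Slip l (n + 2).
  have := s_step f a n; have := s_step f a (n + 1).
  rewrite (_ : n + 1 + 1 = n + 2); last by lia.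
  case: (eqVneq l (n + 1)) => [->|] /=; lia.
case: (eqVneq b (n + 1)) => [->|bn]; last first.
  by exists b; rewrite s_sigma (negbTE bn) /=; lia.
have := s_step f a n; have := s_step f a (n + 1).
rewrite (_ : n + 1 + 1 = n + 2); last by lia.
case: (boolP ((f n < a) && (f (n + 1) < a))) => fa s1 s0.
  by exists n; rewrite s_sigma; lia.
by exists (n + 2); rewrite s_sigma; lia.
Qed.

Theorem theorem1p1 :
  [/\ (forall alpha beta : asp,
         bruhat_min [set gamma | bruhat alpha (demazure gamma beta)]
           (lresidual alpha beta^-1%g)),
      (forall op : asp -> asp -> asp,
         op =2 lresidual <->
         (forall (alpha beta : asp) (a b : int),
            is_max (fun l => (s alpha a l)%:Z - (s beta^-1%g b l)%:Z)
              (s (op alpha beta) a b)%:Z))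
    & (forall (alpha : asp) (n : int),
         lresidual alpha (sigma n) =
         if alpha (n + 1) < alpha n then (alpha * sigma n)%g else alpha)].
Proof.
split.
- move=> f g; apply: residual_min => a b.
  by have := @lresidualP f g^-1%g a b; rewrite invgK.
- move=> op; split=> [opE f g a b|opP f g]; first by rewrite opE; exact: lresidualP.
  by apply/esym/lresidual_eq/opP.
- exact: lresidual_sigma.
Qed.
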